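(* For every $n\geq 2$, the ladder graph $L_n$ satisfies $F_d(L_n)=\lceil \frac{n}{2}\rceil+1$.
   Context: The ladder graph $L_n$ is the Cartesian product of the path $P_n$ on $n$ vertices with the path $P_2$ on $2$ vertices. Zero forcing: given a set $B\subseteq V(G)$ of initially black vertices (all others white) of a finite simple graph $G$, at each step a black vertex having exactly one white neighbor forces that neighbor to become black; $B$ is a zero forcing set of $G$ if repeated application of this rule turns all vertices black. A set $D\subseteq V(G)$ is dominating if every vertex of $G$ is in $D$ or adjacent to a vertex of $D$. A dom-forcing set of $G$ is a set $D_f\subseteq V(G)$ that is both a dominating set of $G$ and a zero forcing set of $G$; the dom-forcing number $F_d(G)$ is the minimum cardinality of a dom-forcing set. *)

(* Defs.v *)
From HB Require Import structures.
From mathcomp Require Import all_boot.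

Set Implicit Arguments.
Unset Strict Implicit.
Unset Printing Implicit Defensive.

Record sgraph := SGraph {
  vertex :> finType;
  adj : rel vertex;
  adj_sym : symmetric adj;
  adj_irr : irreflexive adj }.

(* The path on n vertices 0 - 1 - ... - n.-1. *)
Definition path_adj (n : nat) : rel 'I_n :=
  fun i j => (i.+1 == j :> nat) || (j.+1 == i :> nat).

Lemma path_adj_sym n : symmetric (@path_adj n).
Proof. by move=> i j; rewrite /path_adj orbC. Qed.

Lemma path_adj_irr n : irreflexive (@path_adj n).
Proof. by move=> i; rewrite /path_adj orbb gtn_eqF. Qed.

Definition path_graph (n : nat) : sgraph :=
  SGraph (@path_adj_sym n) (@path_adj_irr n).

Definition cart_adj (G H : sgraph) : rel (G * H) :=
  fun x y => ((x.1 == y.1) && adj x.2 y.2) || (adj x.1 y.1 && (x.2 == y.2)).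

Lemma cart_adj_sym (G H : sgraph) : symmetric (@cart_adj G H).
Proof.
by move=> x y; rewrite /cart_adj !(eq_sym y.1, eq_sym y.2) !(@adj_sym _ y.1, @adj_sym _ y.2).
Qed.

Lemma cart_adj_irr (G H : sgraph) : irreflexive (@cart_adj G H).
Proof. by move=> x; rewrite /cart_adj !adj_irr andbF. Qed.

Definition cart_graph (G H : sgraph) : sgraph :=
  SGraph (@cart_adj_sym G H) (@cart_adj_irr G H).

Definition ladder (n : nat) : sgraph :=
  cart_graph (path_graph n) (path_graph 2).

Section DomForcing.

Variable G : sgraph.
Implicit Types B D : {set G}.

Definition white_neighbours B (u : G) : {set G} :=
  [set w | adj u w & w \notin B].

Definition force_step : rel {set G} := fun B B' =>
  [exists u in B, exists v,
    (white_neighbours B u == [set v]) && (B' == v |: B)].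

Definition zero_forcing B : bool := connect force_step B [set: G].

Definition dominating D : bool :=
  [forall v, (v \in D) || [exists u in D, adj v u]].

Definition dom_forcing D : bool := dominating D && zero_forcing D.

Lemma dom_forcing_setT : dom_forcing [set: G].
Proof.
by rewrite /dom_forcing /zero_forcing connect0 andbT; apply/forallP=> v; rewrite inE.
Qed.

(* setT is only the seed of the search; by dom_forcing_setT it is admissible,
   so this is a genuine minimum. *)
Definition dom_forcing_number : nat :=
  #|[arg min_(D < [set: G] | dom_forcing D) #|D|]|.

Lemma dom_forcing_numberP :
  (exists2 D, dom_forcing D & #|D| = dom_forcing_number) /\
  (forall D, dom_forcing D -> dom_forcing_number <= #|D|).
Proof.
rewrite /dom_forcing_number; case: arg_minnP => [|D dD minD].
  exact: dom_forcing_setT.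
by split; [exists D | exact: minD].
Qed.

End DomForcing.

(* Main.v *)
(** Lower bound: if [u] is the vertex that performs the first force, then all
    neighbours of [u] but one lie in [D].  Counting the pairs (d, v) with [d] in
    [D] and [v] in the closed neighbourhood of [d], the vertex [u] is counted
    [deg u] times and its black neighbours at least twice; in a graph with
    degrees between 2 and 3 this gives [4 |D| >= |V| + 3], and for the ladder,
    where [|V| = 2 n], rounding yields the bound.

    Upper bound: take one vertex in every other column, ending with the last
    column, in alternating rows, and add one vertex in the first column. *)
Require Import Defs.
From mathcomp Require Import all_boot.
From mathcomp Require Import zify.

Set Implicit Arguments.
Unset Strict Implicit.
Unset Printing Implicit Defensive.

(** * Zero forcing and double counting in an arbitrary graph *)

Section Graph.

Variable G : sgraph.
Implicit Types (B C D : {set G}) (u v w : G).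

Definition neighbours u : {set G} := [set w | adj u w].

Lemma white_neighboursE B u : white_neighbours B u = neighbours u :\: B.
Proof. by apply/setP=> w; rewrite !inE andbC. Qed.

Definition stalled C := forall u v, u \in C -> white_neighbours C u != [set v].

(** Performing a force preserves the hypothesis, as a stalled superset of [v |: B] is also one of
    [B]; when no force is left, [B] itself is stalled. No order of forces has to be exhibited. *)
Lemma zero_forcing_stalled B :
  (forall C, B \subset C -> stalled C -> C = setT) -> zero_forcing B.
Proof.
have [m] := ubnP #|~: B|; elim: m B => // m IHm B ltBm stallB.
have [[u /andP[Bu /existsP[v /eqP wv]]]|stalled_B] :=
    @existsP _ (fun u => (u \in B) && [exists v, white_neighbours B u == [set v]]).
  have /setDP[_ B'v] : v \in neighbours u :\: B.
    by rewrite -white_neighboursE wv set11.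
  apply: (@connect_trans _ _ (v |: B)).
    apply/connect1/existsP; exists u; rewrite Bu.
    by apply/existsP; exists v; rewrite wv !eqxx.
  apply: IHm => [|C /subUsetP[_ sBC]]; last exact: stallB.
  suff : #|~: (v |: B)| < #|~: B| by lia.
  have := cardsC B; have := cardsC (v |: B); rewrite cardsU1 B'v; lia.
rewrite /zero_forcing (stallB B) ?connect0 // => u v Bu.
apply/negP=> wv; apply: stalled_B; exists u; rewrite Bu.
by apply/existsP; exists v.
Qed.

Lemma stalled_mem C u v : stalled C -> u \in C -> adj u v ->
  (forall w, adj u w -> w != v -> w \in C) -> v \in C.
Proof.
move=> stC Cu uv nbC; apply: contraT => C'v.
case/negP: (stC u v Cu); apply/eqP/setP=> w; rewrite !inE.
have [->|neq_wv] := eqVneq w v; first by rewrite uv.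
by case: (boolP (adj u w)) => //= uw; rewrite nbC.
Qed.

(** The vertex making the first force has exactly one white neighbour. If no force is made, [B] is
    full and any vertex will do. *)
Lemma zero_forcing_few_white B : 0 < #|G| -> zero_forcing B ->
  exists2 u, u \in B & #|white_neighbours B u| <= 1.
Proof.
move=> /card_gt0P[u0 _] /connectP[[|B1 p] /= pathB lastB].
  exists u0; first by rewrite -lastB inE.
  by rewrite white_neighboursE -lastB setDT cards0.
case/andP: pathB => /existsP[u /andP[Bu /existsP[v /andP[/eqP wv _]]]] _.
by exists u; rewrite // wv cards1.
Qed.

Lemma sum_closed_neighbours D :
  \sum_(d in D) #|neighbours d|.+1 = \sum_v #|D :&: (v |: neighbours v)|.
Proof.
have cardE (A : {set G}) : #|A| = \sum_v (v \in A) by rewrite -sum1_card big_mkcond.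
have irrE v : v \notin neighbours v by rewrite inE adj_irr.
transitivity (\sum_(d in D) \sum_v (v \in d |: neighbours d)).
  by apply: eq_bigr => d _; rewrite -cardE cardsU1 irrE.
rewrite exchange_big; apply: eq_bigr => v _; rewrite cardE big_mkcond.
by apply: eq_bigr => d _; rewrite !inE eq_sym adj_sym; case: (d \in D).
Qed.

(** Domination counts each vertex once. Each black neighbour of [u] adds two: it counts [u] once
    more, and is itself counted both by itself and by [u]. *)
Lemma dominating_excess D u : dominating D -> u \in D ->
  #|G| + 2 * #|D :&: neighbours u| <= \sum_(d in D) #|neighbours d|.+1.
Proof.
move=> /forallP domD Du; rewrite sum_closed_neighbours.
set k := #|D :&: neighbours u|.
(* The excess is spread as [k] at [u] and 1 at each black neighbour of [u], so that the sums compare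
   term by term. *)
have -> : #|G| + 2 * k =
    \sum_(v : G) (1 + ((v == u) * k + (v \in D :&: neighbours u))).
  rewrite !big_split /= sum1_card -big_distrl /= (bigD1 u) //= eqxx.
  rewrite big1 => [|v /negPf-> //].
  have -> : \sum_v (v \in D :&: neighbours u) = k by rewrite /k -sum1_card [RHS]big_mkcond.
  by congr addn; lia.
apply: leq_sum => v _; have [->|neq_vu] := eqVneq v u.
  have -> : D :&: (u |: neighbours u) = u |: D :&: neighbours u.
    by apply/setP=> w; rewrite !inE; case: eqVneq => // ->; rewrite Du.
  rewrite cardsU1 !inE adj_irr andbF /=.
  by rewrite mul1n addn0.
rewrite mul0n add0n; case: (boolP (v \in _)) => [|_]; last first.
  rewrite addn0 card_gt0; apply/set0Pn.
  case/orP: (domD v) => [Dv|/existsP[w /andP[Dw vw]]].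
    by exists v; rewrite !inE Dv eqxx.
  by exists w; rewrite !inE Dw vw orbT.
rewrite !inE => /andP[Dv uv]; rewrite -[1 + _]/2.
have <- : #|[set u; v]| = 2 by rewrite cards2 eq_sym neq_vu.
apply: subset_leq_card; apply/subsetP=> w; rewrite !inE.
by case/orP=> /eqP->; rewrite ?Du ?Dv ?eqxx //= adj_sym uv orbT.
Qed.

Lemma dom_forcing_card_ge (d1 d2 : nat) D : 0 < #|G| ->
  (forall v, d1 <= #|neighbours v| <= d2) -> dom_forcing D ->
  #|G| + d1 + d2 <= d2.+1 * #|D| + 2.
Proof.
move=> G_gt0 degG /andP[domD /zero_forcing_few_white[//|u Du]].
rewrite white_neighboursE => few_white.
have := dominating_excess domD Du; have := cardsID D (neighbours u).
(* The summand of [u] stays exact, [deg u + 1]: against the excess, at least [2 (deg u - 1)], it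
   leaves one [deg u], which is at least [d1]. *)
rewrite setIC (bigD1 u) //= (cardsD1 u D) Du.
have : \sum_(i in D | i != u) #|neighbours i|.+1 <= d2.+1 * #|D :\ u|.
  rewrite -sum1_card big_distrr /=.
  rewrite [X in _ <= X](eq_bigl (fun i => (i \in D) && (i != u))); last first.
    by move=> i; rewrite !inE andbC.
  by apply: leq_sum => i _; rewrite muln1 ltnS; case/andP: (degG i).
have := degG u; nia.
Qed.

End Graph.

(** * Degrees in products and paths *)

Lemma card_neighbours_cart (G H : sgraph) (x : cart_graph G H) :
  #|neighbours x| = #|neighbours x.1| + #|neighbours x.2|.
Proof.
have -> : neighbours x =
    setX (neighbours x.1) [set x.2] :|: setX [set x.1] (neighbours x.2).
  by apply/setP=> y; rewrite !inE orbC !(eq_sym y.1, eq_sym y.2).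
rewrite cardsU !cardsX !cards1 muln1 mul1n.
rewrite (_ : _ :&: _ = set0) ?cards0 ?subn0 //; apply/setP=> y; rewrite !inE.
by apply/negP=> /andP[/andP[xy _] /andP[/eqP eq_xy _]]; rewrite eq_xy adj_irr in xy.
Qed.

Lemma card_neighbours_path n (i : path_graph n) :
  #|neighbours i| = (0 < i) + (i.+1 < n).
Proof.
have sum_eq (m : nat) : \sum_(j < n) (m == j) = (m < n).
  have [ltmn|lenm] := ltnP m n; last by rewrite big1 // => j _; have := ltn_ord j; lia.
  by rewrite (bigD1 (Ordinal ltmn)) //= eqxx big1 // => j; rewrite -val_eqE /=; lia.
(* The factor [0 < i] discards the truncated predecessor [0.-1 = 0]. *)
have -> : #|neighbours i| = \sum_(j < n) ((i.+1 == j) + ((0 < i) * (i.-1 == j))).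
  rewrite -sum1_card big_mkcond; apply: eq_bigr => j _; rewrite inE /= /path_adj.
  by case: ifP; lia.
by rewrite big_split -big_distrr /= !sum_eq; have := ltn_ord i; lia.
Qed.

(** * The ladder: an optimal set and the two bounds *)

Section Ladder.

Variable n : nat.
Hypothesis n_gt1 : 1 < n.
Implicit Types x y : ladder n.

(** Coordinates are natural numbers, so that adjacency is arithmetic for [lia]. *)
Definition column x : nat := x.1.
Definition row x : nat := x.2.

Lemma column_lt x : column x < n. Proof. exact: ltn_ord. Qed.
Lemma row_lt2 x : row x < 2. Proof. exact: ltn_ord. Qed.

Lemma ladder_vertex c r : c < n -> r < 2 -> {x | column x = c & row x = r}.
Proof. by move=> ltcn ltr2; exists (Ordinal ltcn, Ordinal ltr2). Qed.

Lemma ladder_eqE x y : (x == y) = (column x == column y) && (row x == row y).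
Proof. by rewrite -pair_eqE. Qed.

Lemma ladder_adjE x y : adj x y =
  (column x == column y) && (row x != row y) ||
  (((column x).+1 == column y) || ((column y).+1 == column x))
    && (row x == row y).
Proof.
have -> : adj x y = (column x == column y) &&
      (((row x).+1 == row y) || ((row y).+1 == row x)) ||
    (((column x).+1 == column y) || ((column y).+1 == column x))
      && (row x == row y) by [].
by have := row_lt2 x; have := row_lt2 y; lia.
Qed.

(** Columns [n - 1], [n - 3], and so on. The shift by [odd n] makes the first chosen vertex (1, 0)
    for even [n] and (0, 1) for odd [n], both adjacent to the corner (0, 0). *)
Definition alternating : {set ladder n} :=
  [set x | (odd (column x) != odd n) &&
           (row x == odd (column x)./2 (+) odd n)].

Lemma card_alternating : #|alternating| <= uphalf n.
Proof.
rewrite -[uphalf n]card_ord.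
have half_lt x : x \in alternating -> (column x)./2 < uphalf n.
  by rewrite inE => /andP[par _]; have := column_lt x; lia.
have u_gt0 : 0 < uphalf n by lia.
(* Halving is injective on columns of one parity; by [half_lt] the default is not reached on
   [alternating]. *)
pose f x := insubd (Ordinal u_gt0) (column x)./2.
rewrite -(@card_in_imset _ _ f alternating) ?max_card // => x y Dx Dy.
move/(congr1 val); rewrite !val_insubd (half_lt x) // (half_lt y) // => eq_half.
move: Dx Dy; rewrite !inE => /andP[px /eqP rx] /andP[py /eqP ry].
apply/eqP; rewrite ladder_eqE rx ry eq_half eqxx andbT.
by lia.
Qed.

Definition alternating_dom : {set ladder n} :=
  [set x | (column x == 0) && (row x == 0)] :|: alternating.

Lemma card_alternating_dom : #|alternating_dom| <= uphalf n + 1.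
Proof.
apply: leq_trans (leq_card_setU _ _).1 _; rewrite addnC.
apply: leq_add card_alternating _; apply/card_le1_eqP=> x y; rewrite !inE.
by move=> x0 y0; apply/eqP; rewrite ladder_eqE; lia.
Qed.

Lemma mem_alternating_dom x : (x \in alternating_dom) =
  (column x == 0) && (row x == 0) ||
  (odd (column x) != odd n) && (row x == odd (column x)./2 (+) odd n).
Proof. by rewrite !inE. Qed.

(** A chosen vertex dominates its own column. An unchosen column other than 0 lies between two
    chosen ones with opposite rows, so each of its vertices has a chosen neighbour in its row. *)
Lemma dominating_alternating_dom : dominating alternating_dom.
Proof.
apply/forallP=> x; have ltcx := column_lt x; have ltrx := row_lt2 x.
suff [c [r [ltcn ltr2 Dcr xcr]]] : exists c r, [/\ c < n, r < 2,
    (c == 0) && (r == 0) || (odd c != odd n) && (r == odd c./2 (+) odd n) &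
    [|| column x == c, ((column x).+1 == c) && (row x == r)
      | (c.+1 == column x) && (row x == r)]].
  have [y yc yr] := ladder_vertex ltcn ltr2.
  have Dy : y \in alternating_dom by rewrite mem_alternating_dom yc yr.
  have [->|neq_xy] := eqVneq x y; first by rewrite Dy.
  apply/orP; right; apply/existsP; exists y; rewrite Dy ladder_adjE.
  by move: neq_xy; rewrite ladder_eqE; lia.
have [par|/negPn/eqP par] := boolP (odd (column x) != odd n).
  exists (column x), (odd (column x)./2 (+) odd n : nat).
  by rewrite par !eqxx orbT; split=> //; case: addb.
case: (column x) ltcx par => [|m] ltmn par; first by exists 0, 0; split; lia.
have [rx|rx] := eqVneq (row x) (odd m.+2./2 (+) odd n).
  by exists m.+2, (row x); split; lia.
exists m, (row x); split; rewrite ?eqxx ?orbT //; first exact: ltnW.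
rewrite -par /=; apply/orP; right.
move: rx ltrx; rewrite -par /=.
by case: (row x) (odd m) (odd m./2) => [|[|]] // [] [].
Qed.

(** Once columns up to [c] are black, each vertex of column [c] forces the next one in its row. *)
Lemma zero_forcing_alternating_dom : zero_forcing alternating_dom.
Proof.
apply: zero_forcing_stalled => C /subsetP sDC stC.
suff colC c x : column x <= c -> x \in C.
  by apply/setP=> x; rewrite inE (colC (column x)).
elim: c x => [|c IHc] x lexc; have ltrx := row_lt2 x.
  have [Dx|D'x] := boolP (x \in alternating_dom); first exact: sDC.
  have [y yc yr] := @ladder_vertex 0 0 (ltnW n_gt1) isT.
  have Dy : y \in alternating_dom by rewrite mem_alternating_dom yc yr.
  (* Column 0 starts black for odd [n]; for even [n] the corner forces (0, 1), its other neighbour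
     (1, 0) being black. *)
  have [xc xr n_even] : [/\ column x = 0, row x = 1 & odd n = false].
    have xc : column x = 0 by lia.
    by move: D'x ltrx; rewrite mem_alternating_dom xc; case: (row x) (odd n) => [|[|]] [].
  apply: (stalled_mem stC (sDC y Dy)) => [|w].
    by rewrite ladder_adjE xc xr yc yr.
  rewrite ladder_adjE ladder_eqE xc xr yc yr => yw neq_wx; apply: sDC.
  have [wc wr] : column w = 1 /\ row w = 0 by have := row_lt2 w; lia.
  by rewrite mem_alternating_dom wc wr n_even.
have [/IHc//|ltcx] := leqP (column x) c.
have ltcn : c < n by have := column_lt x; lia.
have [y yc yr] := ladder_vertex ltcn ltrx.
have Cy : y \in C by apply: IHc; rewrite yc.
apply: (stalled_mem stC Cy) => [|w]; rewrite ladder_adjE; first by lia.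
by rewrite ladder_eqE => yw neq_wx; apply: IHc; lia.
Qed.

Lemma dom_forcing_number_ladder_le : dom_forcing_number (ladder n) <= uphalf n + 1.
Proof.
have [_ minD] := dom_forcing_numberP (ladder n).
apply: leq_trans (minD _ _) card_alternating_dom.
by rewrite /dom_forcing dominating_alternating_dom zero_forcing_alternating_dom.
Qed.

Lemma dom_forcing_number_ladder_ge : uphalf n + 1 <= dom_forcing_number (ladder n).
Proof.
have [[E dfE <-] _] := dom_forcing_numberP (ladder n).
have cardL : #|ladder n| = n * 2 by rewrite card_prod !card_ord.
(* The rung gives 1, and the row gives 1 or 2 since [1 < n]. *)
have degL x : 2 <= #|neighbours x| <= 3.
  rewrite card_neighbours_cart !card_neighbours_path.
  by have := ltn_ord x.1; have := ltn_ord x.2; lia.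
have L_gt0 : 0 < #|ladder n| by lia.
by have := dom_forcing_card_ge L_gt0 degL dfE; lia.
Qed.

End Ladder.

(* [uphalf n] is the ceiling of n / 2. *)
Theorem theorem2p10 (n : nat) (hn : 2 <= n) :
  dom_forcing_number (ladder n) = uphalf n + 1.
Proof.
apply/eqP; rewrite eqn_leq dom_forcing_number_ladder_le //.
exact: dom_forcing_number_ladder_ge.
Qed.
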